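(* For every $r \in \{2,\dots,9\}$ there are infinitely many integers $\Delta \geq r+2$ such that there exists a graph $G$ with maximum degree $\Delta(G)=\Delta$ and $\chi_r(G) = (r-1)\Delta(G)+1$.
   Context: Graphs are finite and simple. For a vertex $v$, $N(v)$ is its set of neighbors and $\deg(v)=|N(v)|$; $\Delta(G)$ is the maximum vertex degree. For a coloring $\phi$ and a vertex set $U$, $\phi(U)=\{\phi(u):u\in U\}$. An $r$-hued coloring of $G$ is a proper vertex coloring $\phi$ such that $|\phi(N(v))| \geq \min\{r,\deg(v)\}$ for every vertex $v$; the $r$-hued chromatic number $\chi_r(G)$ is the minimum number of colors in an $r$-hued coloring of $G$. *)

(* Defs.v *)
From mathcomp Require Import all_boot.

Set Implicit Arguments.
Unset Strict Implicit.
Unset Printing Implicit Defensive.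

Record sgraph := SGraph {
  vertex :> finType;
  adj : rel vertex;
  adj_sym : symmetric adj;
  adj_irrefl : irreflexive adj
}.

Definition nbhd (G : sgraph) (v : G) : {set G} := [set u | adj v u].

Definition deg (G : sgraph) (v : G) : nat := #|nbhd v|.

Definition max_deg (G : sgraph) : nat := \max_(v : G) deg v.

Definition proper_coloring (G : sgraph) (C : finType) (phi : {ffun G -> C}) :
  bool := [forall u, forall v, adj u v ==> (phi u != phi v)].

Definition hued_coloring (r : nat) (G : sgraph) (C : finType)
    (phi : {ffun G -> C}) : bool :=
  proper_coloring phi && [forall v, minn r (deg v) <= #|phi @: nbhd v|].

Definition hued_colorable (r : nat) (G : sgraph) (k : nat) : bool :=
  [exists phi : {ffun G -> 'I_k}, hued_coloring r phi].

(* Giving all vertices distinct colors is always an r-hued coloring, so the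
   minimum defining the r-hued chromatic number exists. *)
Lemma hued_colorable_ex (r : nat) (G : sgraph) :
  exists k, hued_colorable r G k.
Proof.
exists #|G|; apply/existsP; exists [ffun v => enum_rank v].
have inj : injective [ffun v : G => enum_rank v].
  by move=> u v; rewrite !ffunE; apply: enum_rank_inj.
apply/andP; split.
  apply/forallP=> u; apply/forallP=> v; apply/implyP=> uv.
  by apply/eqP=> /inj euv; rewrite euv adj_irrefl in uv.
by apply/forallP=> v; rewrite card_imset // geq_minr.
Qed.

Definition hued_chromatic (r : nat) (G : sgraph) : nat :=
  ex_minn (hued_colorable_ex r G).

(* Main.v *)
Require Import Defs.
From mathcomp Require Import all_boot.
From mathcomp Require Import all_algebra all_field zify ring.

Set Implicit Arguments.
Unset Strict Implicit.
Unset Printing Implicit Defensive.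

(** In the incidence graph of a Steiner system [S(2, r, v)] with [D] blocks
    through each point, a block vertex has degree [r] and hence forces its [r]
    points to have distinct colors; any two points lie on a block, so at least
    [v = (r - 1) * D + 1] colors are needed.  Conversely, give the points
    distinct colors and single out [r] blocks through each point.  Coloring the
    blocks greedily so that blocks singled out by a common point get distinct
    colors, each block has to avoid its [r] points and at most [r * (r - 1)]
    other blocks, and [r ^ 2 < v] as soon as [D >= r + 2].  The Steiner systems
    come from affine spaces over [F_q] ([r = q]) and, for [r = 6], from
    projective spaces over [F_5] ([r = q + 1]). *)

(** * Greedy coloring with forbidden colors *)

(** Induction on [s], the head being colored last: it avoids [F v] and the current colors of all its
    [e]-neighbors, which together miss some color of [C]. *)
Lemma greedy_list_coloring (V C : finType) (e : rel V) (F : V -> {set C})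
    (s : seq V) (c0 : C) :
  symmetric e ->
  {in s, forall v, #|F v| + #|[set u | e v u]| < #|C|} ->
  exists f : V -> C, {in s, forall v, f v \notin F v} /\
    {in s &, forall u v, u != v -> e u v -> f u != f v}.
Proof.
move=> esym; elim: s => [|v s IHs] few; first by exists (fun=> c0); split.
have [u us|f [fF fe]] := IHs; first by apply: few; rewrite inE us orbT.
pose bad := F v :|: f @: [set u | e v u].
have [c cbad] : exists c, c \notin bad.
  apply/existsP; rewrite -negb_forall; apply/negP => /forallP allbad.
  have := few v (mem_head _ _); rewrite ltnNge => /negP; apply.
  have -> : #|C| = #|bad| by apply: eq_card => c; rewrite allbad.
  by rewrite (leq_trans (leq_card_setU _ _)) // leq_add2l leq_imset_card.
have {cbad} [cF cN] : c \notin F v /\ forall u, e v u -> f u != c.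
  move: cbad; rewrite inE negb_or => /andP[-> cN]; split=> // u vu.
  by apply: contraNneq cN => <-; apply: imset_f; rewrite inE.
exists (fun u => if u == v then c else f u); split=> [u|u w].
  rewrite inE; case: eqP => [-> //|_ /= us]; exact: fF.
rewrite !inE; case: eqP => [->|_] /= us; case: eqP => [->|_] //= ws.
- by rewrite eqxx.
- by move=> _ /cN; rewrite eq_sym.
- by move=> _; rewrite esym => /cN.
- exact: fe.
Qed.

Lemma leq_card_bigcup (I T : finType) (P : pred I) (A : I -> {set T}) :
  #|\bigcup_(i | P i) A i| <= \sum_(i | P i) #|A i|.
Proof.
elim/big_ind2: _ => [|m B k C Bm Ck|//].
  by rewrite cards0.
by rewrite (leq_trans (leq_card_setU B C)) // leq_add.
Qed.

(** * Steiner systems and their point degrees *)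

Definition steiner2 (r : nat) (T : finType) (B : {set {set T}}) : Prop :=
  (forall b, b \in B -> #|b| = r) /\
  forall x y, x != y -> #|[set b in B | (x \in b) && (y \in b)]| = 1.

(** Double counting of pairs [(y, b)] with [y != x] and both points in [b]: each [y] shares one
    block with [x], and each block through [x] has [r - 1] other points. *)
Lemma steiner2_degree (r : nat) (T : finType) (B : {set {set T}}) (x : T) :
  0 < r -> steiner2 r B -> #|T| = (r - 1) * #|[set b in B | x \in b]| + 1.
Proof.
move=> r0 [Br B1].
rewrite -cardsT (cardsD1 x) inE addnC; congr (_ + _).
rewrite -sum1_card.
transitivity (\sum_(y in [set: T] :\ x)
   \sum_(b in [set b in B | x \in b] | y \in b) 1).
  apply: eq_bigr => y; rewrite !inE andbT eq_sym => /B1 B1y.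
  by rewrite -[LHS]B1y -sum1_card; apply: eq_bigl => b; rewrite !inE andbA.
rewrite (exchange_big_dep (mem [set b in B | x \in b])) //=.
  rewrite mulnC -sum_nat_const; apply: eq_bigr => b; rewrite inE => /andP[bB xb].
  rewrite -(Br b bB) (cardsD1 x b) xb addKn -sum1_card.
  by apply: eq_bigl => y; rewrite !inE bB !andbT.
by move=> y b _ /andP[].
Qed.

(** A line containing distinct [x] and [y] contains [L x y]; both have [r] points, so they
    coincide. *)
Lemma steiner2_lines (r : nat) (T : finType) (L : T -> T -> {set T}) :
  (forall x y, x \in L x y) -> (forall x y, y \in L x y) ->
  (forall x y, x != y -> #|L x y| = r) ->
  (forall x y u v, u \in L x y -> v \in L x y -> L u v \subset L x y) ->
  steiner2 r [set L p.1 p.2 | p in [pred p | p.1 != p.2]].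
Proof.
move=> L1 L2 Lr Lsub; split=> [_ /imsetP[p pP ->]|x y xy]; first exact: Lr.
apply/eqP/cards1P; exists (L x y); apply/setP=> b; rewrite !inE.
apply/andP/eqP => [[/imsetP[p pP ->] /andP[xp yp]]|->].
  by apply/eqP; rewrite eq_sym eqEcard Lsub //= !Lr.
by rewrite L1 L2; split=> //; apply/imsetP; exists (x, y).
Qed.

(** * The incidence graph and its hued chromatic number *)

Section IncidenceGraph.

Variables (T : finType) (B : {set {set T}}).

(* Subsets outside [B] become isolated vertices, which constrain neither the
   maximum degree nor the colorings. *)
Definition incidence_adj (u v : T + {set T}) : bool :=
  match u, v with
  | inl x, inr b | inr b, inl x => (b \in B) && (x \in b)
  | _, _ => false
  end.

Lemma incidence_sym : symmetric incidence_adj.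
Proof. by case=> ? []. Qed.

Lemma incidence_irrefl : irreflexive incidence_adj.
Proof. by case. Qed.

Definition incidence_graph : sgraph := SGraph incidence_sym incidence_irrefl.

Lemma nbhd_point (x : T) :
  nbhd (inl x : incidence_graph) = inr @: [set b in B | x \in b].
Proof.
apply/setP=> -[y|b]; rewrite inE /=; first by apply/esym/imsetP => -[].
by rewrite mem_imset ?inE // => ? ? [].
Qed.

Lemma nbhd_block (b : {set T}) :
  nbhd (inr b : incidence_graph) = if b \in B then inl @: b else set0.
Proof.
apply/setP=> -[y|c]; rewrite inE /=; case: ifP => // bB; rewrite ?inE //.
  by rewrite mem_imset // => ? ? [].
by apply/esym/imsetP => -[].
Qed.

Lemma deg_point (x : T) :
  deg (inl x : incidence_graph) = #|[set b in B | x \in b]|.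
Proof. by rewrite /deg nbhd_point card_imset // => ? ? []. Qed.

Lemma deg_block (b : {set T}) :
  deg (inr b : incidence_graph) = if b \in B then #|b| else 0.
Proof.
rewrite /deg nbhd_block; case: ifP => _; last exact: cards0.
by rewrite card_imset // => ? ? [].
Qed.

Variables (r D : nat).
Hypotheses (r2 : 2 <= r) (rD : r + 2 <= D).
Hypotheses (stB : steiner2 r B) (cardT : #|T| = (r - 1) * D + 1).

Lemma card_blocks_through (x : T) : #|[set b in B | x \in b]| = D.
Proof. by have := @steiner2_degree r T B x (ltnW r2) stB; nia. Qed.

Lemma max_deg_incidence : max_deg incidence_graph = D.
Proof.
have /card_gt0P[x _] : 0 < #|T| by rewrite cardT addn1.
apply/eqP; rewrite eqn_leq; apply/andP; split.
  apply/bigmax_leqP => -[y|b] _; first by rewrite deg_point card_blocks_through.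
  rewrite deg_block; case: ifP => // bB; rewrite (proj1 stB) //; lia.
by rewrite -{1}(card_blocks_through x) -deg_point /max_deg leq_bigmax.
Qed.

Lemma incidence_hued_geq (k : nat) :
  hued_colorable r incidence_graph k -> #|T| <= k.
Proof.
case/existsP=> phi /andP[_ /forallP hued].
rewrite -[k]card_ord; apply: (@leq_card _ _ (fun x => phi (inl x))) => x y exy.
apply/eqP; apply: contraT => xy.
have /eqP/cards1P[b] := proj2 stB _ _ xy.
move/setP/(_ b); rewrite !inE eqxx => /and3P[bB xb yb].
have := hued (inr b); rewrite deg_block nbhd_block bB (proj1 stB) // minnn.
rewrite -(proj1 stB b bB) -{1}(@card_imset _ (T + {set T})%type inl);
  last by move=> ? ? [].
(* The neighborhood of [b] has exactly as many colors as vertices, so [phi] is injective on it. *)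
move=> /(conj (leq_imset_card phi (mem (inl @: b)))) /andP.
rewrite -eqn_leq => /imset_injP inj.
suff [xy'] : inl x = inl y :> T + {set T} by rewrite xy' eqxx in xy.
by apply: inj; rewrite ?imset_f.
Qed.

Lemma incidence_hued_colorable : hued_colorable r incidence_graph #|T|.
Proof.
have /card_gt0P[c0 _] : 0 < #|T| by rewrite cardT addn1.
have /fin_all_exists[ch chP] (x : T) : exists A : {set {set T}},
    A \subset [set b in B | x \in b] /\ #|A| = r.
  have /card_geqP[s [us ss sB]] : r <= #|[set b in B | x \in b]|.
    by rewrite card_blocks_through; lia.
  exists [set:: s]; split; last by rewrite cardsE (card_uniqP us).
  by apply/subsetP=> b; rewrite inE; apply: sB.
have chB x b : b \in ch x -> (b \in B) && (x \in b).
  by case: (chP x) => /subsetP/(_ b) sub _ /sub; rewrite inE.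
pose e (b c : {set T}) := (b != c) && [exists x, (b \in ch x) && (c \in ch x)].
have esym : symmetric e.
  move=> b c; rewrite /e eq_sym; congr (_ && _).
  by apply: eq_existsb => x; rewrite andbC.
(* The colors are the points themselves, and taking [id] for the forbidden sets makes each block
   avoid the colors of its own points. *)
have [|f [fb fe]] := @greedy_list_coloring _ T e id (enum B) c0 esym.
  move=> b; rewrite mem_enum => bB; rewrite (proj1 stB) // cardT.
  suff : #|[set c | e b c]| <= r * (r - 1).
    (* Here [r + r * (r - 1) = r ^ 2], while [(r - 1) * (r + 2) + 1 = r ^ 2 + r - 1] is larger. *)
    move: #|_| r2 => k; have := leq_mul (leqnn (r - 1)) rD.
    by case: r => // s; rewrite subn1; nia.
  have sub : [set c | e b c] \subset
      \bigcup_(x in [set x in b | b \in ch x]) (ch x :\ b).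
    apply/subsetP=> c; rewrite inE => /andP[bc /existsP[x /andP[bx cx]]].
    apply/bigcupP; exists x.
      by rewrite inE bx; case/andP: (chB _ _ bx) => _ ->.
    by rewrite !inE cx eq_sym bc.
  apply: leq_trans (subset_leq_card sub) _.
  apply: leq_trans (leq_card_bigcup _ _) _.
  apply: (@leq_trans (\sum_(x in [set x in b | b \in ch x]) (r - 1))).
    apply: leq_sum => x; rewrite inE => /andP[_ bx].
    by rewrite -(proj2 (chP x)) (cardsD1 b (ch x)) bx addKn.
  rewrite sum_nat_const leq_mul2r -(proj1 stB b bB); apply/orP; right.
  by apply/subset_leq_card/subsetP=> x; rewrite inE => /andP[].
apply/existsP;
  exists [ffun v => enum_rank (match v with inl x => x | inr b => f b end)].
apply/andP; split.
  apply/forallP=> -[x|b]; apply/forallP=> -[y|c] //=; rewrite !ffunE;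
    apply/implyP=> /andP[bB xb]; rewrite (inj_eq enum_rank_inj).
    by apply: contraTneq xb => ->; apply: fb; rewrite mem_enum.
  by apply: contraTneq xb => <-; apply: fb; rewrite mem_enum.
apply/forallP=> -[x|b].
  rewrite (leq_trans (geq_minl _ _)) // -{1}(proj2 (chP x)).
  (* The [r] blocks of [ch x] are pairwise [e]-related, so they alone give [r] colors around [x]. *)
  rewrite -(@card_in_imset _ _ (fun b => enum_rank (f b)) (ch x)).
    apply/subset_leq_card/subsetP=> _ /imsetP[b bx ->].
    rewrite nbhd_point -imset_comp; apply/imsetP; exists b.
      by rewrite inE chB.
    by rewrite /= ffunE.
  move=> b c bx cx /enum_rank_inj fbc; apply/eqP; apply: contraT => bc.
  have [/andP[bB _] /andP[cB _]] := (chB _ _ bx, chB _ _ cx).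
  have := fe b c; rewrite !mem_enum fbc eqxx; apply=> //.
  by rewrite /e bc; apply/existsP; exists x; rewrite bx.
rewrite deg_block nbhd_block; case: ifP => bB; last by rewrite minn0.
rewrite -imset_comp card_imset ?geq_minr // => x y /=.
by rewrite !ffunE => /enum_rank_inj.
Qed.

Lemma hued_chromatic_incidence : hued_chromatic r incidence_graph = #|T|.
Proof.
rewrite /hued_chromatic; case: ex_minnP => k /incidence_hued_geq Tk mink.
by apply/eqP; rewrite eqn_leq Tk mink // incidence_hued_colorable.
Qed.

End IncidenceGraph.

Definition steiner2_unbounded (r : nat) : Prop := forall M, exists T : finType,
  exists2 B : {set {set T}}, steiner2 r B & M < #|T|.

(** * Affine and projective geometries over a finite field *)

Section FieldGeometry.

Local Open Scope ring_scope.
Import GRing.Theory.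

Variables (F : finFieldType) (n : nat).
Local Notation V := 'rV[F]_n.

Definition affine_line (x y : V) : {set V} := [set x + t *: (y - x) | t : F].

Lemma affine_steiner2 :
  steiner2 #|F| [set affine_line p.1 p.2 | p in [pred p : V * V | p.1 != p.2]].
Proof.
apply: steiner2_lines => [x y|x y|x y xy|x y u v].
- by apply/imsetP; exists 0; rewrite // scale0r addr0.
- by apply/imsetP; exists 1; rewrite // scale1r addrC subrK.
- rewrite card_imset // => s t /addrI /eqP.
  rewrite -subr_eq0 -scalerBl scaler_eq0 !subr_eq0 (eq_sym y) (negPf xy) orbF.
  by move/eqP.
- move=> /imsetP[s _ ->] /imsetP[t _ ->]; apply/subsetP=> _ /imsetP[c _ ->].
  apply/imsetP; exists (s + c * (t - s)) => //.
  by apply/rowP=> i; rewrite !mxE; ring.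
Qed.

Definition ray (v : V) : {set V} := [set a *: v | a in [set~ 0 : F]].

(** A canonical representative of [v] up to nonzero scalars; the choice succeeds since [v] lies in
    [ray v]. *)
Definition normal (v : V) : V := odflt 0 [pick u in ray v].

Lemma normalP (v : V) : exists2 a : F, a != 0 & normal v = a *: v.
Proof.
rewrite /normal; case: pickP => [u /imsetP[a]|]; first by rewrite !inE; exists a.
by move/(_ v) => /imsetP[]; exists 1; rewrite ?scale1r // !inE oner_eq0.
Qed.

(** Proportional vectors have the same ray, and the choice depends only on the ray. *)
Lemma normalZ (a : F) (v : V) : a != 0 -> normal (a *: v) = normal v.
Proof.
move=> a0; congr odflt; apply: eq_pick => u /=.
apply/imsetP/imsetP => -[b]; rewrite !inE => b0 ->.
  by exists (b * a); rewrite ?scalerA // !inE mulf_neq0.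
by exists (b / a); rewrite ?scalerA ?divfK // !inE mulf_neq0 ?invr_eq0.
Qed.

Lemma normal_idem (v : V) : normal (normal v) = normal v.
Proof. by have [a a0 nv] := normalP v; rewrite {1}nv normalZ. Qed.

Lemma normal_eq0 (v : V) : (normal v == 0) = (v == 0).
Proof. by have [a a0 ->] := normalP v; rewrite scaler_eq0 (negPf a0). Qed.

Lemma normal_inj (u v : V) :
  normal u = normal v -> exists2 a : F, a != 0 & u = a *: v.
Proof.
have [[a a0 ->] [b b0 ->]] := (normalP u, normalP v) => eab.
exists (a^-1 * b); first by rewrite mulf_neq0 ?invr_eq0.
by rewrite -scalerA -eab scalerA mulVf // scale1r.
Qed.

(* A projective point is represented by a chosen nonzero vector on it. *)
Definition proj_point : finType := {v : V | (v != 0) && (normal v == v)}.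

Lemma normal_proj (p : proj_point) : normal (val p) = val p.
Proof. by have /andP[_ /eqP] := valP p. Qed.

Lemma proj_neq0 (p : proj_point) : val p != 0.
Proof. by have /andP[] := valP p. Qed.

Definition proj_line (x y : proj_point) : {set proj_point} :=
  [set z | [exists a, exists b, val z == a *: val x + b *: val y]].

Lemma proj_lineP (x y z : proj_point) :
  reflect (exists a b, val z = a *: val x + b *: val y) (z \in proj_line x y).
Proof.
rewrite inE; apply: (iffP existsP) => -[a].
  by case/existsP=> b /eqP; exists a, b.
by case=> b /eqP ez; exists a; apply/existsP; exists b.
Qed.

(** Representatives of distinct points are linearly independent: if they were proportional,
    normalizing would identify them. *)
Lemma proj_free (x y : proj_point) (a b c d : F) : x != y ->
  a *: val x + b *: val y = c *: val x + d *: val y -> a = c /\ b = d.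
Proof.
move=> xy eabcd.
have {eabcd} eab : (a - c) *: val x = (d - b) *: val y.
  by apply/eqP; rewrite !scalerBl subr_eq addrAC eq_sym subr_eq addrC eabcd addrC.
suff /andP[] : (a - c == 0) && (d - b == 0).
  by rewrite !subr_eq0 => /eqP-> /eqP->.
have [a0|a0] := eqVneq (a - c) 0.
  by move/eqP: eab; rewrite a0 scale0r eq_sym scaler_eq0 (negPf (proj_neq0 y)) orbF.
have [b0|b0] := eqVneq (d - b) 0.
  move/eqP: eab; rewrite b0 scale0r scaler_eq0 (negPf (proj_neq0 x)) orbF.
  by rewrite (negPf a0).
case/eqP: xy; apply: val_inj.
by rewrite -normal_proj -(normalZ _ a0) eab (normalZ _ b0) normal_proj.
Qed.

(* [None] stands for [y]; every other point of the line through [x] and [y]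
   has exactly one representative of the form [x + t y]. *)
Lemma card_proj_line (x y : proj_point) :
  x != y -> #|proj_line x y| = #|F|.+1.
Proof.
move=> xy.
(* The coefficients 0 and 1 are written out so that [proj_free] applies to both cases. *)
pose g (o : option F) : V :=
  if o is Some t then 1 *: val x + t *: val y else 0 *: val x + 1 *: val y.
have g0 o : g o != 0.
  apply/eqP => /esym; have -> : 0 = 0 *: val x + 0 *: val y :> V.
    by rewrite !scale0r addr0.
  have := oner_neq0 F.
  case: o => [t|] o1 /(proj_free xy)[e0 e1]; move: o1;
    by rewrite -?e0 -?e1 eqxx.
have normg_inj : injective (normal \o g).
  move=> o o' /= /normal_inj[a a0].
  case: o o' => [s|] [t|] //=; rewrite scalerDr !scalerA => /(proj_free xy)[].
  - by rewrite mulr1 => <- ->; rewrite mul1r.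
  - by move/eqP; rewrite mulr0 oner_eq0.
  - by move/eqP; rewrite mulr1 eq_sym (negPf a0).
rewrite -card_option -(card_imset _ val_inj) -(card_imset _ normg_inj).
apply: eq_card => v; apply/imsetP/imsetP => [[z]|[o _ ->]].
  case/proj_lineP=> a [b ez] ->; rewrite -(normal_proj z).
  have [a0|a0] := eqVneq a 0.
    have := proj_neq0 z; rewrite ez a0 scale0r add0r scaler_eq0 negb_or.
    by case/andP=> b0 _; exists None; rewrite //= scale0r add0r scale1r normalZ.
  rewrite ez.
  exists (Some (b / a)) => //=; rewrite -[RHS](normalZ _ a0); congr normal.
  by rewrite scalerDr !scalerA mulr1 mulrC divfK.
have Pg : (normal (g o) != 0) && (normal (normal (g o)) == normal (g o)).
  by rewrite normal_eq0 g0 normal_idem eqxx.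
exists (Sub (normal (g o)) Pg : proj_point); last by rewrite SubK.
have [a _ nga] := normalP (g o); apply/proj_lineP; rewrite SubK nga.
case: o {Pg nga} => [t|]; rewrite /= scalerDr !scalerA.
  by exists (a * 1), (a * t).
by exists (a * 0), (a * 1).
Qed.

Lemma projective_steiner2 : steiner2 #|F|.+1
  [set proj_line p.1 p.2 | p in [pred p : proj_point * proj_point | p.1 != p.2]].
Proof.
apply: steiner2_lines => [x y|x y||x y u v].
- by apply/proj_lineP; exists 1, 0; rewrite scale1r scale0r addr0.
- by apply/proj_lineP; exists 0, 1; rewrite scale1r scale0r add0r.
- exact: card_proj_line.
- case/proj_lineP=> a [b eu] /proj_lineP[c [d ev]].
  apply/subsetP=> z /proj_lineP[s [t ez]]; apply/proj_lineP.
  exists (s * a + t * c), (s * b + t * d); rewrite ez eu ev.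
  by apply/rowP=> i; rewrite !mxE; ring.
Qed.

(** Every nonzero vector is a scalar multiple of a representative; the 1 accounts for the zero
    vector. *)
Lemma card_proj_point : (#|F| ^ n <= #|F| * #|proj_point| + 1)%N.
Proof.
have -> : (#|F| ^ n = #|{: V}|)%N by rewrite card_mx mul1n.
have sub : [set: V] \subset
    0 |: [set c.1 *: val c.2 | c : (F * proj_point)%type].
  apply/subsetP=> v _; rewrite !inE; case: eqVneq => //= v0.
  have Pv : (normal v != 0) && (normal (normal v) == normal v).
    by rewrite normal_eq0 v0 normal_idem eqxx.
  have [a a0 nv] := normalP v; apply/imsetP.
  exists (a^-1, Sub (normal v) Pv : proj_point) => //=.
  by rewrite nv scalerA mulVf // scale1r.
have := subset_leq_card sub; rewrite cardsT cardsU1 => le_V.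
rewrite (leq_trans le_V) // addnC leq_add ?leq_b1 // -card_prod.
exact: leq_imset_card.
Qed.

End FieldGeometry.

(** * Unbounded families and the conclusion *)

Lemma steiner2_unbounded_affine (F : finFieldType) : steiner2_unbounded #|F|.
Proof.
move=> M; exists 'rV[F]_M.+1; eexists; first exact: affine_steiner2.
by rewrite card_mx mul1n ltnW // ltn_expl // card_finNzRing_gt1.
Qed.

Lemma steiner2_unbounded_projective (F : finFieldType) :
  steiner2_unbounded #|F|.+1.
Proof.
move=> M; exists (proj_point F M.+2); eexists; first exact: projective_steiner2.
have F1 : 1 < #|F| := card_finNzRing_gt1 F.
have : M.+1 < #|F| ^ M.+1 by apply: ltn_expl.
(* Since [#|F| > 1], the bound yields at least [#|F| ^ M.+1] projective points. *)
by have := card_proj_point F M.+2; rewrite expnS; nia.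
Qed.

Lemma steiner2_unbounded_small (r : nat) : 2 <= r <= 9 -> steiner2_unbounded r.
Proof.
move=> /andP[r2 r9].
have affine p k : prime p -> 0 < k -> steiner2_unbounded (p ^ k).
  by move=> pp /(pPrimePowerField pp)[F _ <-]; apply: steiner2_unbounded_affine.
have projective p : prime p -> steiner2_unbounded p.+1.
  by move=> /card_Fp <-; apply: steiner2_unbounded_projective.
(* All values are prime powers except 6, obtained as the size of a projective line over the field
   with 5 elements. *)
have : r \in [:: 2 ^ 1; 3 ^ 1; 2 ^ 2; 5 ^ 1; 5.+1; 7 ^ 1; 2 ^ 3; 3 ^ 2].
  by rewrite !inE; lia.
rewrite !inE; do ?[case/orP]; move/eqP->;
  by first [apply: affine | apply: projective].
Qed.

Theorem theorem6 (r : nat) (hr : 2 <= r <= 9) :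
  forall N : nat, exists D : nat,
    [/\ N <= D, r + 2 <= D &
      exists G : sgraph,
        max_deg G = D /\ hued_chromatic r G = (r - 1) * max_deg G + 1].
Proof.
move=> N; have r2 : 2 <= r by case/andP: hr.
(* As [#|T| = (r - 1) * D + 1], this threshold forces [D >= N + r + 2]. *)
have [T [B stB MT]] := steiner2_unbounded_small hr ((r - 1) * (N + r + 2)).
have /card_gt0P[x _] : 0 < #|T| by apply: leq_ltn_trans MT.
have cardT := steiner2_degree x (ltnW r2) stB.
pose D := #|[set b in B | x \in b]|.
have ND : N + r + 2 <= D.
  by move: MT; rewrite cardT addn1 ltnS leq_pmul2l // subn_gt0.
have rD : r + 2 <= D by lia.
exists D; split=> //; first lia.
exists (incidence_graph B); have mD := max_deg_incidence r2 rD stB cardT.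
by split=> //; rewrite mD (hued_chromatic_incidence r2 rD stB cardT).
Qed.
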